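(* Let $f:\mathbb{R}^d\to\mathbb{R}$ be $\ell$-smooth with $\ell>0$, let the stochastic gradient $g(x;\xi)$ be unbiased with variance bounded by $\sigma^2$, and let $f(x_0)-\min_{x\in\mathbb{R}^d}f(x)\le\Delta$. Run NSGD, $$x_{t+1}=x_t-\frac{\gamma_t}{\|g(x_t;\xi_t)\|}\,g(x_t;\xi_t),\qquad \gamma_t=\frac{\gamma}{\sqrt{t+1}}.$$ Then for any $\gamma>0$ and every integer $T\ge2$, $$\frac1T\sum_{t=0}^{T-1}\mathbb{E}\|\nabla f(x_t)\|\le 3\left(\frac{\Delta}{\gamma}+\ell\gamma\log(T)\right)T^{-1/2}+24\sigma.$$
   Context: A function $f:\mathbb{R}^d\to\mathbb{R}$ is $\ell$-smooth if it is differentiable and $\|\nabla f(x_1)-\nabla f(x_2)\|\le \ell\|x_1-x_2\|$ for all $x_1,x_2\in\mathbb{R}^d$. Stochastic gradient oracle: for every $x\in\mathbb{R}^d$, $\mathbb{E}_\xi[g(x;\xi)]=\nabla f(x)$ and $\mathbb{E}_\xi\|g(x;\xi)-\nabla f(x)\|^2\le\sigma^2$, with $\sigma\ge 0$. The samples $\xi_0,\xi_1,\dots$ are drawn afresh at each iteration (independently of the past) from the distribution of $\xi$. If the stochastic gradient is zero, the update step is taken to be zero. $x_0$ is a deterministic initial point, and $\log$ is the natural logarithm. *)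

(* Defs.v *)
From mathcomp Require Import all_boot all_order all_algebra.
From mathcomp Require Import all_classical all_reals all_analysis.

Set Implicit Arguments.
Unset Strict Implicit.
Unset Printing Implicit Defensive.

Import Order.TTheory GRing.Theory Num.Theory.
Import numFieldNormedType.Exports.

Local Open Scope classical_set_scope.
Local Open Scope ring_scope.

(* The norm that the library puts on 'rV[R]_d is the sup norm, hence the
   explicit definition.  The two norms are equivalent, so that the library's
   [differentiable] and [open] on 'rV[R]_d are the usual notions. *)
Definition enorm (R : realType) (d : nat) (v : 'rV[R]_d) : R :=
  Num.sqrt (\sum_(i < d) v 0 i ^+ 2).

Definition grad (R : realType) (d : nat) (f : 'rV[R]_d -> R) (x : 'rV[R]_d) :
    'rV[R]_d :=
  \row_(i < d) 'D_(delta_mx 0 i) f x.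

Definition smooth (R : realType) (d : nat) (l : R) (f : 'rV[R]_d -> R) : Prop :=
  (forall x, differentiable f x) /\
  (forall x1 x2, enorm (grad f x1 - grad f x2) <= l * enorm (x1 - x2)).

(* R^d with its Borel sigma-algebra. *)
Notation borel_rV R d := (g_sigma_algebraType (@open 'rV[R]_d)).

(* [D] is the law of the sample xi.  Joint measurability is what gives
   the iterates, and hence all the expectations, a meaning.  For a measurable
   integrand an expectation that equals a real number forces integrability, so
   unbiasedness includes the integrability of g(x; xi). *)
Definition stochastic_oracle (R : realType) (d : nat) (dXi : measure_display)
    (Xi : measurableType dXi) (D : probability Xi R)
    (f : 'rV[R]_d -> R) (sigma : R) (g : 'rV[R]_d -> Xi -> 'rV[R]_d) : Prop :=
  [/\ measurable_fun [set: borel_rV R d * Xi]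
        (fun p : borel_rV R d * Xi => g p.1 p.2 : borel_rV R d),
      forall x (i : 'I_d), ('E_D[fun z => g x z 0%R i] = (grad f x 0%R i)%:E)%E
    & forall x, ('E_D[fun z => (enorm (g x z - grad f x) ^+ 2)%R]
                   <= (sigma ^+ 2)%:E)%E].

Definition mutually_independent (R : realType) (dO dXi : measure_display)
    (Omega : measurableType dO) (Xi : measurableType dXi)
    (P : probability Omega R) (xi : nat -> {RV P >-> Xi}) : Prop :=
  forall (J : seq nat) (A : nat -> set Xi), uniq J ->
    (forall j, j \in J -> measurable (A j)) ->
    P (\bigcap_(j in [set` J]) (xi j @^-1` A j)) =
    (\prod_(j <- J) P (xi j @^-1` A j))%E.

Definition iid_samples (R : realType) (dO dXi : measure_display)
    (Omega : measurableType dO) (Xi : measurableType dXi)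
    (P : probability Omega R) (D : probability Xi R)
    (xi : nat -> {RV P >-> Xi}) : Prop :=
  mutually_independent xi /\
  (forall t (A : set Xi), measurable A -> distribution P (xi t) A = D A).

Definition step_size (R : realType) (gamma : R) (t : nat) : R :=
  gamma / Num.sqrt t.+1%:R.

(* When the stochastic gradient v is zero, so is the step c *: v. *)
Definition nsgd_step (R : realType) (d : nat) (gamma_t : R) (x v : 'rV[R]_d) :
    'rV[R]_d :=
  x - (gamma_t / enorm v) *: v.

Fixpoint nsgd (R : realType) (d : nat) (Xi : Type)
    (g : 'rV[R]_d -> Xi -> 'rV[R]_d) (gamma : R) (x0 : 'rV[R]_d)
    (xi : nat -> Xi) (t : nat) : 'rV[R]_d :=
  if t is s.+1 then
    let x := nsgd g gamma x0 xi s in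
    nsgd_step (step_size gamma s) x (g x (xi s))
  else x0.

(* Main.v *)
Require Import Defs.
From HB Require Import structures.
From mathcomp Require Import all_boot all_order all_algebra.
From mathcomp Require Import all_classical all_reals all_analysis.
From mathcomp Require Import measurable_realfun ring lra.

Set Implicit Arguments.
Unset Strict Implicit.
Unset Printing Implicit Defensive.

Import Order.TTheory GRing.Theory Num.Theory.
Import numFieldNormedType.Exports.

Local Open Scope classical_set_scope.
Local Open Scope ring_scope.

(* Writing e = v - grad f x, the direction v / |v| satisfies
   <grad f x, v> / |v| >= |v| - |e| >= |grad f x| - 2 |e|, so the descent lemma
   gives, along every path,
     gamma_t |grad f x_t| <= f x_t - f x_(t+1) + 2 gamma_t |e_t| + l gamma_t^2 / 2.
   Summing before taking expectations leaves only nonnegative integrands, so no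
   integrability is needed.  As x_t depends on the samples before t only,
   Tonelli and the variance bound give E |e_t| <= sigma.  Finally
   gamma_t >= gamma / sqrt T, sum gamma_t <= 2 gamma sqrt T and
   sum gamma_t^2 <= gamma^2 (1 + ln T) give the bound with 4 sigma and with
   (1 + ln T) / 2 <= 3 ln T. *)

(** * Euclidean inner product and norm, and the descent lemma *)

Section EuclideanSpace.
Context {R : realType} {d : nat}.
Implicit Types u v w : 'rV[R]_d.

Definition dotv u v : R := \sum_(i < d) u 0 i * v 0 i.

Lemma enorm_ge0 u : 0 <= enorm u. Proof. exact: sqrtr_ge0. Qed.

Lemma sqr_enorm u : enorm u ^+ 2 = dotv u u.
Proof.
rewrite sqr_sqrtr; first by apply: eq_bigr => i _; rewrite expr2.
by apply: sumr_ge0 => i _; exact: sqr_ge0.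
Qed.

Lemma dotvC u v : dotv u v = dotv v u.
Proof. by apply: eq_bigr => i _; rewrite mulrC. Qed.

Lemma dotvDl u v w : dotv (u + v) w = dotv u w + dotv v w.
Proof. by rewrite -big_split; apply: eq_bigr => i _; rewrite mxE mulrDl. Qed.

Lemma dotvZl a u v : dotv (a *: u) v = a * dotv u v.
Proof. by rewrite mulr_sumr; apply: eq_bigr => i _; rewrite mxE mulrA. Qed.

Lemma dotvDr u v w : dotv w (u + v) = dotv w u + dotv w v.
Proof. by rewrite dotvC dotvDl !(dotvC w). Qed.

Lemma dotvZr a u v : dotv u (a *: v) = a * dotv u v.
Proof. by rewrite dotvC dotvZl dotvC. Qed.

Lemma dotvNl u v : dotv (- u) v = - dotv u v.
Proof. by rewrite -scaleN1r dotvZl mulN1r. Qed.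

Lemma dotvNr u v : dotv u (- v) = - dotv u v.
Proof. by rewrite dotvC dotvNl dotvC. Qed.

Lemma enormZ a u : enorm (a *: u) = `|a| * enorm u.
Proof.
apply/eqP; rewrite -(eqrXn2 (n := 2)) ?mulr_ge0 ?enorm_ge0//.
by rewrite exprMn !sqr_enorm dotvZl dotvZr mulrA real_normK ?num_real.
Qed.

Lemma enormN u : enorm (- u) = enorm u.
Proof. by rewrite -scaleN1r enormZ normrN1 mul1r. Qed.

Lemma enorm_eq0 u : enorm u = 0 -> u = 0.
Proof.
move=> u0; have := sqr_enorm u; rewrite u0 expr0n/= => /esym/eqP.
rewrite psumr_eq0; last by move=> i _; rewrite -expr2 sqr_ge0.
move=> /allP ui0; apply/rowP => i; rewrite mxE.
by have := ui0 i (mem_index_enum _); rewrite -expr2 sqrf_eq0 => /eqP.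
Qed.

Lemma normr_coord_le_enorm u i : `|u 0 i| <= enorm u.
Proof.
rewrite -sqrtr_sqr ler_wsqrtr// (bigD1 i)//= lerDl sumr_ge0// => j _.
exact: sqr_ge0.
Qed.

(** Cauchy-Schwarz: for a = |u|, b = |v| and c = <u, v>, expanding |b u - a v|^2 >= 0 gives 2 a b (a
    b - c) >= 0. Dividing by a b requires both norms to be positive, so zero vectors are split off
    first. *)
Lemma dotv_le_enorm u v : dotv u v <= enorm u * enorm v.
Proof.
have [/enorm_eq0 ->|v0] := eqVneq (enorm v) 0.
  by rewrite -(scale0r 0) dotvZr mul0r mulr_ge0 ?enorm_ge0.
have vgt0 : 0 < enorm v by rewrite lt_def v0 enorm_ge0.
have [/enorm_eq0 ->|u0] := eqVneq (enorm u) 0.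
  by rewrite -(scale0r 0) dotvZl mul0r mulr_ge0 ?enorm_ge0.
have ugt0 : 0 < enorm u by rewrite lt_def u0 enorm_ge0.
have := sqr_ge0 (enorm (enorm v *: u - enorm u *: v)).
rewrite sqr_enorm !(dotvDl, dotvDr, dotvNl, dotvNr, dotvZl, dotvZr).
rewrite -!sqr_enorm (dotvC v u); move: (enorm u) (enorm v) (dotv u v) ugt0 vgt0.
move=> a b c a0 b0 h; rewrite -(ler_pM2l (mulr_gt0 a0 b0)); nra.
Qed.

Lemma enormD_le u v : enorm (u + v) <= enorm u + enorm v.
Proof.
rewrite -(ler_pXn2r (n := 2)) ?nnegrE ?addr_ge0 ?enorm_ge0//.
have := dotv_le_enorm u v; rewrite sqr_enorm.
rewrite !(dotvDl, dotvDr) -!sqr_enorm (dotvC v u); nra.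
Qed.

Lemma enorm_continuous : continuous (@enorm R d).
Proof.
move=> u; apply: (@continuous_comp _ _ _ (fun v => \sum_(i < d) v 0 i ^+ 2)
  (@Num.sqrt R)); last exact: sqrt_continuous.
apply: continuous_big => [|i _]; first exact: add_continuous.
have ci : continuous (fun v : 'rV[R]_d => v 0 i) by exact: coord_continuous.
move=> v; exact: (continuous_comp (ci v) (@exprn_continuous R 2 _)).
Qed.

Lemma derive_grad (f : 'rV[R]_d -> R) x h :
  differentiable f x -> 'D_h f x = dotv (grad f x) h.
Proof.
move=> df; rewrite deriveE// [in LHS](row_sum_delta h) linear_sum/=.
by apply: eq_bigr => i _; rewrite linearZ/= mxE deriveE// mulrC.
Qed.

Lemma is_derive_line (f : 'rV[R]_d -> R) x h (s : R) :
  differentiable f (x + s *: h) ->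
  is_derive s (1 : R) (fun t => f (x + t *: h)) (dotv (grad f (x + s *: h)) h).
Proof.
move=> df; have := derivableP (diff_derivable (v := h) df).
rewrite derive_grad//.
(* The difference quotient along the line at s is the directional quotient of f at x + s h, as
   functions of t, so existence and value of the limit both transfer. *)
have E : (fun t : R => t^-1 *: (((fun t => f (x + t *: h)) \o shift s) (t *: (1 : R))
            - f (x + s *: h)))
       = (fun t => t^-1 *: ((f \o shift (x + s *: h)) (t *: h) - f (x + s *: h))).
  apply/funext => t; rewrite /= [t *: (1 : R)]mulr1.
  by rewrite scalerDl addrCA.
by case=> ex eq; split; rewrite /derivable /derive E.
Qed.

(** By the mean value theorem instead of an integral: [psi] is f along the segment minus its
    quadratic upper model, and psi 1 - psi 0 = dpsi c. Here dpsi c <= 0 by Cauchy-Schwarz and the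
    Lipschitz bound at distance c |h|. *)
Lemma smooth_descent l (f : 'rV[R]_d -> R) x h : smooth l f ->
  f (x + h) <= f x + dotv (grad f x) h + l / 2 * enorm h ^+ 2.
Proof.
move=> [df gradL].
pose psi s := f (x + s *: h) - (s * dotv (grad f x) h + l / 2 * enorm h ^+ 2 * s ^+ 2).
pose dpsi s := dotv (grad f (x + s *: h)) h
               - (dotv (grad f x) h + l * enorm h ^+ 2 * s).
have dpsiE (s : R) : is_derive s (1 : R) psi (dpsi s).
  apply: is_deriveB; first exact: is_derive_line.
  apply: is_derive_eq.
  by rewrite /GRing.scale/=; field.
have cpsi : {within `[0, 1], continuous psi}.
  apply: continuous_subspaceT => s; apply: differentiable_continuous.
  by apply/derivable1_diffP; case: (dpsiE s).
have [c /[!in_itv]/= /andP[c0 c1]] := MVT ltr01 (fun s _ => dpsiE s) cpsi.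
rewrite /psi scale1r scale0r addr0 subr0 mulr1.
suff : dpsi c <= 0 by nra.
have := dotv_le_enorm (grad f (x + c *: h) - grad f x) h.
rewrite dotvDl dotvNl /dpsi => le1.
have := gradL (x + c *: h) x; rewrite addrAC subrr add0r enormZ gtr0_norm//.
move=> /(ler_wpM2r (enorm_ge0 h)); nra.
Qed.

End EuclideanSpace.

(** * Descent of normalized steps along a single path *)

Section Descent.
Context {R : realType} {d : nat}.
Implicit Types (f : 'rV[R]_d -> R) (x v : 'rV[R]_d).

Lemma nsgd_step_descent l f (c : R) x v : smooth l f -> 0 <= l -> 0 <= c ->
  f (nsgd_step c x v) <=
  f x - c * enorm (grad f x) + 2 * c * enorm (v - grad f x) + l / 2 * c ^+ 2.
Proof.
move=> sf l0 c0; have := smooth_descent x (- (c / enorm v *: v)) sf.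
rewrite -/(nsgd_step c x v) dotvNr dotvZr enormN enormZ.
(* If v = 0 the step is zero and the error is the gradient itself, so - c |grad f x| + 2 c |e| = c
   |grad f x| >= 0. *)
have [/enorm_eq0 ->|v0] := eqVneq (enorm v) 0.
  have -> : dotv (grad f x) 0 = 0 by rewrite -(scale0r 0) dotvZr mul0r.
  rewrite sub0r enormN -(scale0r 0) enormZ normr0 mul0r mulr0 expr0n/= !mulr0.
  by have := mulr_ge0 c0 (enorm_ge0 (grad f x)); nra.
have vgt0 : 0 < enorm v by rewrite lt_def v0 enorm_ge0.
rewrite ger0_norm ?divr_ge0 ?enorm_ge0// divfK//.
have h1 := dotv_le_enorm (v - grad f x) v.
have h2 : enorm (grad f x) <= enorm v + enorm (v - grad f x).
  by have := enormD_le v (grad f x - v); rewrite addrC subrK -[enorm (_ - v)]enormN opprB.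
have h3 : enorm (grad f x) - 2 * enorm (v - grad f x)
          <= dotv (grad f x) v / enorm v.
  rewrite ler_pdivlMr//.
  have : dotv v v = enorm v ^+ 2 by rewrite sqr_enorm.
  by move: h1; rewrite dotvDl dotvNl; nra.
move: h3 => /(ler_wpM2l c0); nra.
Qed.

(** A purely deterministic telescoping: [v] is an arbitrary sequence of directions. Having f xmin in
    place of f (x n) makes the bound usable under the integral without integrability of f (x n). *)
Lemma normalized_path_bound l f (gamma : R) (x v : nat -> 'rV[R]_d) xmin n :
  smooth l f -> 0 <= l -> 0 <= gamma -> (forall x, f xmin <= f x) ->
  (forall t, x t.+1 = nsgd_step (step_size gamma t) (x t) (v t)) ->
  \sum_(0 <= t < n) step_size gamma t * enorm (grad f (x t)) <=
  f (x 0) - f xmin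
  + \sum_(0 <= t < n) 2 * step_size gamma t * enorm (v t - grad f (x t))
  + l / 2 * \sum_(0 <= t < n) step_size gamma t ^+ 2.
Proof.
move=> sf l0 gamma0 fmin xS.
(* The induction needs the telescoped value f (x n), which is weakened to f xmin only at the end. *)
suff : \sum_(0 <= t < n) step_size gamma t * enorm (grad f (x t)) <=
  f (x 0) - f (x n)
  + \sum_(0 <= t < n) 2 * step_size gamma t * enorm (v t - grad f (x t))
  + l / 2 * \sum_(0 <= t < n) step_size gamma t ^+ 2.
  by have := fmin (x n); lra.
elim: n => [|n IHn]; first by rewrite !big_geq//= mulr0 subrr !addr0.
rewrite !big_nat_recr//= mulrDr.
have := nsgd_step_descent (x n) (v n) sf l0
  (divr_ge0 gamma0 (sqrtr_ge0 n.+1%:R)).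
by rewrite -/(step_size gamma n) -xS; lra.
Qed.

End Descent.

(** * Sums of the step sizes and elementary logarithm bounds *)

Section StepSizes.
Context {R : realType}.
Implicit Types (gamma : R) (n : nat).

Lemma sum_step_size_le gamma n : 0 <= gamma ->
  \sum_(0 <= t < n) step_size gamma t <= 2 * gamma * Num.sqrt n%:R.
Proof.
move=> gamma0; elim: n => [|n IHn]; first by rewrite big_geq// sqrtr0 mulr0.
rewrite big_nat_recr//=; apply: (le_trans (lerD IHn (lexx _))).
rewrite /step_size; set a := Num.sqrt n%:R; set b := Num.sqrt n.+1%:R.
have b0 : 0 < b by rewrite sqrtr_gt0 ltr0n.
have ab : b ^+ 2 = a ^+ 2 + 1 by rewrite !sqr_sqrtr ?ler0n// -natr1.
(* With b^2 = a^2 + 1 this is (b - a)^2 >= 0 divided by b; its right-hand side telescopes. *)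
suff : b^-1 <= 2 * (b - a) by move=> /(ler_wpM2l gamma0); nra.
by rewrite -[b^-1]mul1r ler_pdivrMr//; have := sqr_ge0 (b - a); nra.
Qed.

(** The harmonic sum: ln (1 + u) <= u at u = - 1 / (n + 2) gives 1 / (n + 2) <= ln (n + 2) - ln (n +
    1), and the 1 is the first term. *)
Lemma sum_sqr_step_size_le gamma n : (0 < n)%N ->
  \sum_(0 <= t < n) step_size gamma t ^+ 2 <= gamma ^+ 2 * (1 + ln n%:R).
Proof.
have stepE t : step_size gamma t ^+ 2 = gamma ^+ 2 * t.+1%:R^-1.
  by rewrite /step_size exprMn exprVn sqr_sqrtr ?ler0n.
under eq_bigr do rewrite stepE; rewrite -mulr_sumr => n0.
apply: ler_wpM2l; first exact: sqr_ge0.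
case: n n0 => // n _; elim: n => [|n IHn].
  by rewrite big_nat1 invr1 ln1 addr0.
rewrite big_nat_recr//=; apply: (le_trans (lerD IHn (lexx _))).
have n2 : 0 < n.+2%:R :> R by rewrite ltr0n.
have n1 : 0 < n.+1%:R :> R by rewrite ltr0n.
have : ln (1 + - n.+2%:R^-1) <= - n.+2%:R^-1 :> R.
  by apply: le_ln1Dx; rewrite ltrN2 invf_lt1// ltr1n.
have -> : 1 + - n.+2%:R^-1 = n.+1%:R / n.+2%:R :> R.
  apply: (mulIf (lt0r_neq0 n2)); rewrite divfK ?gt_eqF//.
  by rewrite mulrBl mulVf ?gt_eqF// mul1r -natr1 addrK.
rewrite ln_div ?posrE//; move: n.+2%:R^-1 => u; lra.
Qed.

Lemma step_size_ge gamma n t : 0 <= gamma -> (t < n)%N ->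
  gamma / Num.sqrt n%:R <= step_size gamma t.
Proof.
move=> gamma0 tn; rewrite ler_wpM2l// lef_pV2 ?posrE ?sqrtr_gt0 ?ltr0n//.
  by rewrite ler_wsqrtr// ler_nat.
exact: leq_ltn_trans tn.
Qed.

(** Lets a multiple of ln T absorb the 1 in 1 + ln T. It comes from ln (1 / 2) <= - 1 / 2, hence ln
    2 >= 1 / 2. *)
Lemma ln_ge_half n : (2 <= n)%N -> 1 / 2 <= ln n%:R :> R.
Proof.
move=> n2; have n0 : 0 < n%:R :> R by rewrite ltr0n (leq_trans _ n2).
have : ln (1 + - (1 / 2)) <= - (1 / 2) :> R by apply: le_ln1Dx; lra.
have -> : 1 + - (1 / 2) = 2^-1 :> R by field.
rewrite lnV ?posrE// lerN2 => /le_trans; apply.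
by rewrite ler_ln ?posrE// ler_nat.
Qed.

Lemma natV_sqrt (n : nat) : (n%:R^-1 * Num.sqrt n%:R : R) = n%:R `^ (- (1 / 2)).
Proof.
rewrite powRN mul1r powR12_sqrt ?ler0n//.
case: n => [|n]; first by rewrite sqrtr0 invr0 mulr0.
have s0 : Num.sqrt n.+1%:R != 0 :> R by rewrite gt_eqF// sqrtr_gt0 ltr0n.
by rewrite -{1}(sqr_sqrtr (ler0n R n.+1)) expr2 invfM mulfVK.
Qed.

End StepSizes.

(** * Borel measurability of vector-valued maps *)

Section Measurability.
Context {R : realType} {d : nat}.

Lemma continuous_measurable_rV (h : 'rV[R]_d -> R) : continuous h ->
  measurable_fun [set: borel_rV R d] (h : borel_rV R d -> R).
Proof.
move=> /continuousP ch; apply: (measurability _ (RGenOpens.measurableE R)).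
move=> _ [_ [a [b ->] <-]]; rewrite setTI; apply: sub_sigma_algebra.
exact/ch/interval_open.
Qed.

(** Sup-norm balls are boxes, so each point of U lies in a box with rational corners inside U.
    Indexing by all pairs of rational vectors, with [set0] for the boxes that leave U, keeps the
    union countable. *)
Lemma rV_open_bigcup_rat_box (U : set 'rV[R]_d) : open U ->
  let box (p : 'rV[rat]_d * 'rV[rat]_d) :=
    \bigcap_(i in [set: 'I_d]) [set v : 'rV[R]_d |
      v 0 i \in `]ratr (p.1 0 i), ratr (p.2 0 i)[ ] in
  U = \bigcup_p (if `[< box p `<=` U >] then box p else set0).
Proof.
move=> oU box; apply/seteqP; split => v; last first.
  by move=> [p _]; case: ifPn => // /asboolP; exact.
move=> Uv; have /nbhs_ballP[e /= e0 veU] : nbhs v U by exact: open_nbhs_nbhs.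
have /choice[q1 hq1] i : exists q, ratr q \in `]v 0 i - e, v 0 i[.
  by apply: rat_in_itvoo; rewrite ltrBlDr ltrDl.
have /choice[q2 hq2] i : exists q, ratr q \in `]v 0 i, v 0 i + e[.
  by apply: rat_in_itvoo; rewrite ltrDl.
exists (\row_i q1 i, \row_i q2 i) => //; rewrite ifT.
  move=> i _ /=; rewrite !mxE in_itv/=.
  by move: (hq1 i) (hq2 i); rewrite !in_itv/= => /andP[_ ->] /andP[->].
apply/asboolP => w bw; apply: veU; split => // i j; rewrite (ord1 i).
have := bw j Logic.I; rewrite /= !mxE in_itv/= => /andP[w1 w2].
move: (hq1 j) (hq2 j); rewrite !in_itv/= => /andP[v1 _] /andP[_ v2].
rewrite /ball/= ltr_distlC; apply/andP; split.
  exact: lt_trans w1.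
exact: lt_trans v2.
Qed.

(** Reduces Borel measurability to coordinates: the preimage of an open set is a countable union of
    finite intersections of coordinate preimages. *)
Lemma measurable_fun_rV d0 (T : measurableType d0) (h : T -> borel_rV R d) :
  (forall i, measurable_fun setT (fun t => (h t : 'rV[R]_d) 0 i)) ->
  measurable_fun setT h.
Proof.
move=> mh; apply: (@measurability _ _ _ (borel_rV R d) _ _
  (@open 'rV[R]_d) erefl) => _ [U oU <-].
rewrite setTI (rV_open_bigcup_rat_box oU) preimage_bigcup.
apply: countable_bigcupT_measurable => // p; case: ifP => _; last first.
  by rewrite preimage_set0.
rewrite preimage_bigcap; apply: fin_bigcap_measurable => // i _.
rewrite -[X in measurable X]setTI.
exact: (mh i measurableT _ (measurable_itv `]ratr (p.1 0 i), ratr (p.2 0 i)[)).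
Qed.

Context {d0 : measure_display} {T : measurableType d0}.
Implicit Types u v : T -> 'rV[R]_d.
Local Notation mrV u := (measurable_fun setT (u : T -> borel_rV R d)).

Lemma measurable_coord u i : mrV u -> measurable_fun setT (fun t => u t 0 i).
Proof.
move=> mu; have ci : continuous (fun v : 'rV[R]_d => v 0 i).
  exact: coord_continuous.
exact: (measurableT_comp (continuous_measurable_rV ci) mu).
Qed.

Lemma measurable_enorm u : mrV u -> measurable_fun setT (fun t => enorm (u t)).
Proof.
move=> mu.
exact: (measurableT_comp (continuous_measurable_rV enorm_continuous) mu).
Qed.

Lemma measurable_subrV u v : mrV u -> mrV v -> mrV (fun t => u t - v t).
Proof.
move=> mu mv; apply: measurable_fun_rV => i.
under eq_fun do rewrite !mxE.
by apply: measurable_funB; exact: measurable_coord.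
Qed.

Lemma measurable_nsgd_step c u v : mrV u -> mrV v ->
  mrV (fun t => nsgd_step c (u t) (v t)).
Proof.
move=> mu mv; apply: measurable_subrV => //; apply: measurable_fun_rV => i.
(* The inverse is not continuous at 0, but it is the power -1 on nonnegative reals, which is
   measurable; both take the value 0 at 0. *)
under eq_fun do rewrite !mxE -(powR_inv1 (enorm_ge0 _)).
apply: measurable_funM; last exact: measurable_coord.
apply: measurable_funM => //.
by apply: (measurableT_comp (measurable_powR _)); exact: measurable_enorm.
Qed.

(** The gradient is continuous by its Lipschitz bound. That bound is in [enorm] while neighbourhoods
    come from the sup norm, so continuity of [enorm] is used to see that l * enorm (x - y) tends to
    0. *)
Lemma measurable_grad l (f : 'rV[R]_d -> R) u : smooth l f -> mrV u ->
  mrV (fun t => grad f (u t)).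
Proof.
move=> [_ gradL] mu; apply: measurable_fun_rV => i.
suff cg : continuous (fun x => grad f x 0 i).
  exact: (measurableT_comp (continuous_measurable_rV cg) mu).
move=> x.
have cxy : continuous (fun y : 'rV[R]_d => x - y).
  by move=> y; apply: continuousB; [exact: cst_continuous|exact: cvg_id].
have ce : {for x, continuous (fun y : 'rV[R]_d => enorm (x - y))}.
  exact: (continuous_comp (cxy x) (@enorm_continuous R d _)).
have cvg0 : l * enorm (x - y) @[y --> x] --> l * enorm (x - x).
  exact: (cvgMl_tmp ce).
have enorm0 : enorm (x - x) = 0 by rewrite subrr -(scale0r 0) enormZ normr0 mul0r.
have FF := @nbhs_filter 'rV[R]_d x.
apply/(@cvgrPdist_le _ _ _ _ FF) => e e0.
have /(@cvgrPdist_le _ _ _ _ FF)/(_ _ e0) := cvg0; apply: filterS => y.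
rewrite enorm0 mulr0 sub0r normrN => /(le_trans (ler_norm _)); apply: le_trans.
apply: le_trans (gradL x y); have := normr_coord_le_enorm (grad f x - grad f y) i.
by rewrite !mxE.
Qed.

End Measurability.

(** * Independence of the current state from the samples to come *)

Section FreshSamples.
Context {R : realType} {dO dS dXi : measure_display}.
Context {Omega : measurableType dO} {S : measurableType dS}
  {Xi : measurableType dXi} {P : probability Omega R}.

(* Independence of an event from the rectangles extends to the whole
   product sigma-algebra by uniqueness of measures on a pi-system. *)
Lemma indep_event_pair (X : Omega -> S) (Y : Omega -> Xi) (E : set Omega) :
  measurable_fun setT X -> measurable_fun setT Y -> measurable E ->
  (forall A B, measurable A -> measurable B ->
     P (X @^-1` A `&` Y @^-1` B `&` E) =
     (P (X @^-1` A `&` Y @^-1` B) * P E)%E) ->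
  forall C, measurable C ->
    P ((fun w => (X w, Y w)) @^-1` C `&` E) =
    (P ((fun w => (X w, Y w)) @^-1` C) * P E)%E.
Proof.
move=> mX mY mE indepE C mC.
pose G := [set X @^-1` AB.1 `&` Y @^-1` AB.2 |
           AB in [set AB : set S * set Xi | measurable AB.1 /\ measurable AB.2]].
have mG : G `<=` measurable.
  move=> _ [[A B] /= [mA mB] <-]; apply: measurableI.
    by rewrite -[X in measurable X]setTI; exact: mX.
  by rewrite -[X in measurable X]setTI; exact: mY.
have GT : G setT by exists (setT, setT) => //=; rewrite setTI.
have GI : setI_closed G.
  move=> _ _ [[A B] /= [mA mB] <-] [[A' B'] /= [mA' mB'] <-].
  exists (A `&` A', B `&` B') => /=; last by rewrite !preimage_setI setIACA.
  by split; exact: measurableI.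
(* The pair map is measurable for the sigma-algebra generated by [G], since [G] contains the
   preimages of both coordinates. *)
have sGC : <<s G >> ((fun w => (X w, Y w)) @^-1` C).
  have mXY : measurable_fun [set: g_sigma_algebraType G] (fun w => (X w, Y w)).
    apply: measurable_fun_pair => _ A mA; rewrite setTI;
      apply: sub_sigma_algebra.
      by exists (A, setT) => //=; rewrite preimage_setT setIT.
    by exists (setT, A) => //=; rewrite preimage_setT setTI.
  by have := mXY measurableT C mC; rewrite setTI.
(* The measures compared are P restricted to E and P scaled by P E. The scaling factor must be a
   nonnegative real, hence [fine]; the whole space, an element of [G], serves as the cover of finite
   measure. *)
pose k := NngNum (fine_ge0 (measure_ge0 P E)).
have kE : (k%:num%:E = P E)%E by rewrite /= fineK ?fin_num_measure.
have cover : \bigcup_(i : nat) [set: Omega] = setT.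
  by apply/seteqP; split => // w _; exists 0%N.
have := @g_sigma_algebra_measure_unique _ R Omega G mG (fun=> setT)
  (fun=> GT) cover
  (mrestr P mE) (mscale k P) GI.
rewrite /mrestr/= /mscale kE => unique.
rewrite muleC; apply: unique => //.
  move=> _ [[A B] /= [mA mB] <-]; rewrite /mrestr indepE//; exact: muleC.
move=> _; rewrite /mrestr setTI; apply: le_lt_trans (ltry 1).
exact: probability_le1.
Qed.

Context (D : probability Xi R) (xi : nat -> {RV P >-> Xi}).
Hypothesis xi_iid : iid_samples D xi.
Context (Phi : nat -> S * Xi -> S) (X : nat -> Omega -> S) (x0 : S).
Hypothesis mPhi : forall t, measurable_fun setT (Phi t).
Hypothesis X_init : forall w, X 0 w = x0.
Hypothesis X_step : forall t w, X t.+1 w = Phi t (X t w, xi t w).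

Lemma measurable_adapted t : measurable_fun setT (X t).
Proof.
elim: t => [|t IHt].
  by rewrite (_ : X 0 = cst x0)//; apply/funext => w; rewrite X_init.
rewrite (_ : X t.+1 = Phi t \o (fun w => (X t w, xi t w))); last first.
  by apply/funext => w; rewrite X_step.
by apply: (measurableT_comp (mPhi t)); exact: measurable_fun_pair.
Qed.

Let cyl (J : seq nat) (A : nat -> set Xi) : set Omega :=
  \bigcap_(j in [set` J]) (xi j @^-1` A j).

Let measurable_cyl J A : (forall j, j \in J -> measurable (A j)) ->
  measurable (cyl J A).
Proof.
move=> mA; apply: fin_bigcap_measurable => [|j /= /mA mAj].
  exact: finite_seq.
by rewrite -[X in measurable X]setTI; exact: measurable_funP.
Qed.

(* All the future samples at once, since the step from t to t.+1 uses the
   independence of X t from xi t together with the samples after t. *)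
Lemma future_samples_indep t (J : seq nat) A B : uniq J ->
  (forall j, j \in J -> (t <= j)%N) -> (forall j, j \in J -> measurable (A j)) ->
  measurable B ->
  P (X t @^-1` B `&` cyl J A) = (P (X t @^-1` B) * P (cyl J A))%E.
Proof.
have [xi_indep _] := xi_iid.
elim: t J A B => [|t IHt] J A B uJ tJ mA mB.
  have [Bx0|Bx0] := pselect (B x0).
    rewrite (_ : X 0 @^-1` B = setT) ?setTI ?probability_setT ?mul1e//.
    by apply/seteqP; split => // w _; rewrite /= X_init.
  rewrite (_ : X 0 @^-1` B = set0) ?set0I ?measure0 ?mul0e//.
  by apply/seteqP; split => // w /=; rewrite X_init.
(* The state at t + 1 is a function of the pair (X t, xi t), so it suffices to make this pair
   independent of the cylinder, and rectangles are enough for that. *)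
have -> : X t.+1 @^-1` B = (fun w => (X t w, xi t w)) @^-1` (Phi t @^-1` B).
  by apply/seteqP; split => w /=; rewrite X_step.
apply: indep_event_pair => //; first exact: measurable_adapted.
- exact: measurable_cyl.
- move=> B' C mB' mC.
  have tNJ : t \notin J by apply/negP => /tJ; rewrite ltnn.
  (* As t is not in J, the event on xi t merges with the cylinder into one over t :: J. The
     induction hypothesis for t :: J and for [:: t], with mutual independence, then separates the
     factors. *)
  pose A' j := if j == t then C else A j.
  have A't : A' t = C by rewrite /A' eqxx.
  have A'J j : j \in J -> A' j = A j.
    by rewrite /A'; case: eqVneq => // -> tJ'; rewrite tJ' in tNJ.
  have mA' j : j \in t :: J -> measurable (A' j).
    by rewrite inE => /orP[/eqP ->|jJ]; rewrite ?A't// A'J//; exact: mA.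
  have cylE : xi t @^-1` C `&` cyl J A = cyl (t :: J) A'.
    apply/seteqP; split => [w [Cw Jw] j /=|w Jw].
      by rewrite inE => /orP[/eqP ->|jJ]; rewrite ?A't// A'J//; exact: Jw.
    split; first by rewrite -A't; apply: Jw; rewrite /= inE eqxx.
    by move=> j /= jJ; rewrite -A'J//; apply: Jw; rewrite /= inE jJ orbT.
  have cyl1 : xi t @^-1` C = cyl [:: t] A'.
    apply/seteqP; split => [w Cw j /=|w /(_ t)].
      by rewrite inE => /eqP ->; rewrite A't.
    by rewrite A't; apply; rewrite /= inE.
  rewrite -setIA cylE IHt//=; last 2 first.
  - by rewrite tNJ.
  - by move=> j; rewrite inE => /orP[/eqP -> //|/tJ /ltnW].
  rewrite cyl1 IHt//; last 2 first.
  - by move=> j; rewrite inE => /eqP ->.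
  - by move=> j; rewrite inE => /eqP ->; rewrite A't.
  rewrite -muleA; congr (_ * _)%E.
  rewrite -cyl1 /cyl !xi_indep//=; last by rewrite tNJ.
  rewrite big_cons A't; congr (_ * _)%E.
  by apply: eq_big_seq => j jJ; rewrite A'J.
- by rewrite -[X in measurable X]setTI; exact: mPhi.
Qed.

(** The joint law of X t and xi t is the product of the law of X t and D: they agree on rectangles
    by [future_samples_indep] with J = [:: t]. Tonelli then gives the iterated integral. *)
Lemma integral_fresh_sample (h : S * Xi -> \bar R) t :
  measurable_fun setT h -> (forall p, 0 <= h p)%E ->
  (\int[P]_w h (X t w, xi t w) =
   \int[P]_w \int[D]_z h (X t w, z))%E.
Proof.
move=> mh h0; have [_ xiD] := xi_iid.
have mX := measurable_adapted t.
have mXxi : measurable_fun setT (fun w => (X t w, xi t w)).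
  exact: measurable_fun_pair.
pose Xm : {mfun Omega >-> S} := HB.pack (X t) (isMeasurableFun.Build _ _ _ _ _ mX).
pose Zm : {mfun Omega >-> (S * Xi)%type} :=
  HB.pack (fun w => (X t w, xi t w)) (isMeasurableFun.Build _ _ _ _ _ mXxi).
have lawE : forall C, measurable C ->
    (distribution P Xm \x D)%E C = distribution P Zm C.
  apply: product_measure_unique => A B mA mB.
  have cyl1 : xi t @^-1` B = cyl [:: t] (fun=> B).
    apply/seteqP; split => [w Bw j /=|w /(_ t)].
      by rewrite inE => /eqP ->.
    by apply; rewrite /= inE.
  rewrite /distribution /pushforward /= -(xiD t)// /distribution /pushforward.
  rewrite cyl1 -future_samples_indep//.
    by rewrite -cyl1.
  by move=> j; rewrite inE => /eqP ->.
transitivity (\int[distribution P Zm]_p h p)%E.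
  by rewrite ge0_integral_distribution.
rewrite (eq_measure_integral (distribution P Xm \x D)%E); last first.
  by move=> C mC _; exact/esym/lawE.
rewrite fubini_tonelli1// ge0_integral_distribution//.
  exact: measurable_fun_fubini_tonelli_F.
by move=> x; exact: integral_ge0.
Qed.

End FreshSamples.

(* 2 Y <= Y^2 / c + c with c = sigma + e; the e > 0 covers sigma = 0. *)
Lemma integral_le_of_sqr {R : realType} {dO : measure_display}
    {T : measurableType dO} {P : probability T R} (Y : T -> R) (sigma : R) :
  measurable_fun setT Y -> (forall w, 0 <= Y w) -> 0 <= sigma ->
  (\int[P]_w (Y w ^+ 2)%:E <= (sigma ^+ 2)%:E)%E ->
  (\int[P]_w (Y w)%:E <= sigma%:E)%E.
Proof.
move=> mY Y0 sigma0 leY2; apply/lee_addgt0Pr => e e0.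
have c0 : 0 < sigma + e by rewrite ltr_wpDl.
set c := sigma + e in c0 *.
have mY2 : measurable_fun setT (fun w => (Y w ^+ 2)%:E).
  by apply/measurable_EFinP; exact: measurable_funX.
have k0 : 0 <= (2 * c)^-1 by rewrite invr_ge0 mulr_ge0// ltW.
apply: (@le_trans _ _
  (\int[P]_w (((2 * c)^-1)%:E * (Y w ^+ 2)%:E + (c / 2)%:E))%E).
  apply: ge0_le_integral => //.
  - by move=> w _; rewrite lee_fin.
  - exact/measurable_EFinP.
  - by apply: emeasurable_funD => //; exact: measurable_funeM.
  - move=> w _; rewrite -EFinM -EFinD lee_fin invfM -subr_ge0.
    have -> : 2^-1 / c * Y w ^+ 2 + c / 2 - Y w = (Y w - c) ^+ 2 / (2 * c).
      by field; rewrite gt_eqF.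
    by rewrite divr_ge0 ?sqr_ge0// mulr_ge0// ltW.
rewrite ge0_integralD//; first last.
- by move=> w _; rewrite lee_fin divr_ge0// ltW.
- exact: measurable_funeM.
- by move=> w _; rewrite -EFinM lee_fin mulr_ge0// sqr_ge0.
rewrite ge0_integralZl//; last by move=> w _; rewrite lee_fin sqr_ge0.
rewrite integral_cst//= probability_setT mule1.
(* Since sigma <= c, the value sigma^2 / (2 c) + c / 2 is at most c = sigma + e. *)
apply: (@le_trans _ _ (((2 * c)^-1)%:E * (sigma ^+ 2)%:E + (c / 2)%:E)%E).
  by apply: leeD => //; apply: lee_wpmul2l.
rewrite -EFinM -!EFinD lee_fin -/c -subr_ge0.
have -> : c - ((2 * c)^-1 * sigma ^+ 2 + c / 2) = (c ^+ 2 - sigma ^+ 2) / (2 * c).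
  by field; rewrite gt_eqF.
rewrite divr_ge0 ?mulr_ge0 ?(ltW c0)// subr_ge0 ler_pXn2r ?nnegrE ?(ltW c0)//.
by rewrite lerDl ltW.
Qed.

(** * Expected errors and weighted gradient norms of NSGD *)

Section NsgdExpectation.
Context {R : realType} {d : nat} {dO dXi : measure_display}.
Context {Omega : measurableType dO} {P : probability Omega R}.
Context {Xi : measurableType dXi} {D : probability Xi R}.
Context {f : 'rV[R]_d -> R} {g : 'rV[R]_d -> Xi -> 'rV[R]_d}.
Context {xi : nat -> {RV P >-> Xi}} {l sigma : R}.
Hypothesis f_smooth : smooth l f.
Hypothesis g_oracle : stochastic_oracle D f sigma g.
Hypothesis xi_iid : iid_samples D xi.
Variables (gamma : R) (x0 : 'rV[R]_d).

Let x t w := nsgd g gamma x0 (fun s => xi s w) t.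
Let Phi t (p : borel_rV R d * Xi) : borel_rV R d :=
  nsgd_step (step_size gamma t) p.1 (g p.1 p.2).

Let measurable_Phi t : measurable_fun setT (Phi t).
Proof. by have [mg _ _] := g_oracle; exact: measurable_nsgd_step. Qed.

Lemma measurable_nsgd t :
  measurable_fun setT (x t : Omega -> borel_rV R d).
Proof.
exact: (@measurable_adapted _ _ _ _ _ (borel_rV R d) _ P xi Phi x x0).
Qed.

Let err (p : borel_rV R d * Xi) : R := enorm (g p.1 p.2 - grad f p.1).

Let measurable_err : measurable_fun setT err.
Proof.
have [mg _ _] := g_oracle; apply: measurable_enorm; apply: measurable_subrV => //.
exact: (measurable_grad f_smooth).
Qed.

Lemma measurable_nsgd_error t :
  measurable_fun setT (fun w => enorm (g (x t w) (xi t w) - grad f (x t w))).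
Proof.
exact: (measurableT_comp measurable_err
  (measurable_fun_pair (measurable_nsgd t) (measurable_funP (xi t)))).
Qed.

Lemma nsgd_error_le t : 0 <= sigma ->
  (\int[P]_w (enorm (g (x t w) (xi t w) - grad f (x t w)))%:E <= sigma%:E)%E.
Proof.
move=> sigma0; have [mg _ var_g] := g_oracle.
have mh : measurable_fun setT (EFin \o err) by exact/measurable_EFinP.
have h0 p : (0 <= (EFin \o err) p)%E by rewrite lee_fin enorm_ge0.
have := @integral_fresh_sample _ _ _ _ _ (borel_rV R d) _ P D xi xi_iid Phi x x0
  measurable_Phi (fun=> erefl) (fun _ _ => erefl) _ t mh h0.
(* For every fixed value of x t the inner integral over a fresh sample is at most sigma, so the
   outer one averages a constant bound. *)
move=> ->; apply: (@le_trans _ _ (\int[P]_w sigma%:E)%E); last first.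
  by rewrite integral_cst//= probability_setT mule1.
apply: ge0_le_integral => //.
- by move=> w _; exact: integral_ge0.
- apply: (measurableT_comp (measurable_fun_fubini_tonelli_F _ mh h0)).
  exact: measurable_nsgd.
- move=> w _; apply: integral_le_of_sqr => //.
  + exact: (measurableT_comp measurable_err (measurable_fun_pair
      (@measurable_cst _ _ Xi (borel_rV R d) _ (x t w)) (@measurable_id _ Xi _))).
  + by move=> z; exact: enorm_ge0.
  + by have := var_g (x t w); rewrite unlock.
Qed.

Lemma nsgd_weighted_gradients_le xmin n :
  0 <= l -> 0 <= sigma -> 0 <= gamma -> (forall y, f xmin <= f y) ->
  (\sum_(0 <= t < n) (step_size gamma t)%:E * \int[P]_w (enorm (grad f (x t w)))%:E
   <= (f x0 - f xmin + 2 * sigma * \sum_(0 <= t < n) step_size gamma t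
       + l / 2 * \sum_(0 <= t < n) step_size gamma t ^+ 2)%:E)%E.
Proof.
move=> l0 sigma0 gamma0 fmin.
have s0 t : 0 <= step_size gamma t by rewrite divr_ge0 ?sqrtr_ge0.
have mgrad t : measurable_fun setT (fun w => (enorm (grad f (x t w)))%:E).
  apply/measurable_EFinP/measurable_enorm/(measurable_grad f_smooth).
  exact: measurable_nsgd.
have merr t : measurable_fun setT
    (fun w => (enorm (g (x t w) (xi t w) - grad f (x t w)))%:E).
  by apply/measurable_EFinP; exact: measurable_nsgd_error.
(* Nonnegativity of the deterministic part allows the integral of the path bound to be split without
   integrability. *)
have C0 : 0 <= f x0 - f xmin + l / 2 * \sum_(0 <= t < n) step_size gamma t ^+ 2.
  rewrite addr_ge0 ?subr_ge0 ?mulr_ge0 ?divr_ge0// sumr_ge0// => t _.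
  exact: sqr_ge0.
have weightE t :
    ((step_size gamma t)%:E * \int[P]_w (enorm (grad f (x t w)))%:E =
     \int[P]_w ((step_size gamma t)%:E * (enorm (grad f (x t w)))%:E))%E.
  by rewrite ge0_integralZl ?lee_fin// => w _; rewrite lee_fin enorm_ge0.
under eq_bigr do rewrite weightE.
rewrite -ge0_integral_sum//; first last.
- by move=> t w _; rewrite -EFinM lee_fin mulr_ge0 ?enorm_ge0.
- by move=> t; exact: measurable_funeM.
apply: (@le_trans _ _ (\int[P]_w
   ((f x0 - f xmin + l / 2 * \sum_(0 <= t < n) step_size gamma t ^+ 2)%:E +
    \sum_(0 <= t < n) (2 * step_size gamma t)%:E *
       (enorm (g (x t w) (xi t w) - grad f (x t w)))%:E))%E).
  apply: ge0_le_integral => //.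
  - move=> w _; apply: sume_ge0 => t _.
    by rewrite -EFinM lee_fin mulr_ge0 ?enorm_ge0.
  - by apply: emeasurable_sum => t; exact: measurable_funeM.
  - apply: emeasurable_funD => //.
    by apply: emeasurable_sum => t; exact: measurable_funeM.
  - have sumEFinM (a b : nat -> R) : (\sum_(0 <= t < n) (a t)%:E * (b t)%:E =
        (\sum_(0 <= t < n) a t * b t)%:E)%E.
      by rewrite -sumEFin; apply: eq_bigr.
    move=> w _; rewrite !sumEFinM -EFinD lee_fin addrAC.
    exact: (@normalized_path_bound _ _ _ _ _ (fun t => x t w)
      (fun t => g (x t w) (xi t w))).
rewrite ge0_integralD//; first last.
- by apply: emeasurable_sum => t; exact: measurable_funeM.
- move=> w _; apply: sume_ge0 => t _.
  by rewrite -EFinM lee_fin !mulr_ge0 ?enorm_ge0.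
rewrite integral_cst//= probability_setT mule1 ge0_integral_sum//; first last.
- by move=> t w _; rewrite -EFinM lee_fin !mulr_ge0 ?enorm_ge0.
- by move=> t; exact: measurable_funeM.
rewrite [X in (_ <= X%:E)%E]addrAC [leRHS]EFinD leeD2l//.
rewrite mulr_sumr -sumEFin; apply: lee_sum => t _.
rewrite ge0_integralZl ?lee_fin ?mulr_ge0//; last first.
  by move=> w _; rewrite lee_fin enorm_ge0.
rewrite mulrAC [leRHS]EFinM; apply: lee_wpmul2l; first by rewrite lee_fin mulr_ge0.
exact: nsgd_error_le.
Qed.

End NsgdExpectation.

(** * From weighted to uniform averages, and the final constants *)

Theorem proposition1 (R : realType) (d : nat)
    (dO dXi : measure_display)
    (Omega : measurableType dO) (P : probability Omega R)
    (Xi : measurableType dXi) (D : probability Xi R)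
    (f : 'rV[R]_d -> R) (g : 'rV[R]_d -> Xi -> 'rV[R]_d)
    (xi : nat -> {RV P >-> Xi})
    (l sigma Delta gamma : R) (x0 xmin : 'rV[R]_d) (T : nat)
    (hl : 0 < l) (hf : smooth l f)
    (hsigma : 0 <= sigma) (hg : stochastic_oracle D f sigma g)
    (hxi : iid_samples D xi)
    (hmin : forall x, f xmin <= f x) (hDelta : f x0 - f xmin <= Delta)
    (hgamma : 0 < gamma) (hT : (2 <= T)%N) :
  ((T%:R^-1)%:E * \sum_(0 <= t < T)
     'E_P[fun w => enorm (grad f (nsgd g gamma x0 (fun s => xi s w) t))]
   <= (3 * (Delta / gamma + l * gamma * ln T%:R) * T%:R `^ (- (1 / 2))
       + 24 * sigma)%:E)%E.
Proof.
have T0 : (0 < T)%N by exact: leq_trans hT.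
have sT0 : 0 < Num.sqrt T%:R :> R by rewrite sqrtr_gt0 ltr0n.
set G := fun t => ('E_P[fun w => enorm (grad f (nsgd g gamma x0 (fun s => xi s w) t))])%E.
have G0 t : (0 <= G t)%E.
  by rewrite /G unlock; apply: integral_ge0 => w _; rewrite lee_fin enorm_ge0.
(* Every weight with t < T is at least gamma / sqrt T, so this common factor bounds the weighted sum
   from below. *)
have weighted : ((gamma / Num.sqrt T%:R)%:E * \sum_(0 <= t < T) G t <=
    (Delta + 2 * sigma * (2 * gamma * Num.sqrt T%:R)
     + l / 2 * (gamma ^+ 2 * (1 + ln T%:R)))%:E)%E.
  apply: (@le_trans _ _ (\sum_(0 <= t < T) (step_size gamma t)%:E * G t)%E).
    rewrite ge0_sume_distrr//; rewrite !big_seq; apply: lee_sum => t.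
    rewrite mem_index_iota => /andP[_ tT]; apply: lee_wpmul2r => //.
    by rewrite lee_fin step_size_ge// ltW.
  rewrite /G expectation.unlock; apply: (le_trans (nsgd_weighted_gradients_le
    hf hg hxi x0 T (ltW hl) hsigma (ltW hgamma) hmin)).
  rewrite lee_fin; apply: lerD; first apply: lerD => //.
    by rewrite ler_wpM2l ?mulr_ge0// sum_step_size_le// ltW.
  by rewrite ler_wpM2l ?divr_ge0 ?(ltW hl)// sum_sqr_step_size_le.
have k0 : 0 <= T%:R^-1 * (Num.sqrt T%:R / gamma).
  by rewrite mulr_ge0 ?invr_ge0 ?ler0n// divr_ge0 ?sqrtr_ge0// ltW.
have -> : ((T%:R^-1)%:E * \sum_(0 <= t < T) G t =
    (T%:R^-1 * (Num.sqrt T%:R / gamma))%:E *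
    ((gamma / Num.sqrt T%:R)%:E * \sum_(0 <= t < T) G t))%E.
  rewrite muleA -EFinM; congr (_%:E * _)%E.
  by field; rewrite !gt_eqF// ltr0n.
apply: (le_trans (lee_wpmul2l _ weighted)); first by rewrite lee_fin.
rewrite -EFinM lee_fin -natV_sqrt.
have lnT := @ln_ge_half R T hT.
(* With T = s^2 the identities become rational in s; naming the logarithm [L] protects it from that
   rewriting. *)
set s := Num.sqrt T%:R in sT0 *; set L := ln T%:R in lnT *.
have TE : T%:R = s ^+ 2 by rewrite sqr_sqrtr ?ler0n.
rewrite TE.
have -> : (s ^+ 2)^-1 * (s / gamma) * (Delta + 2 * sigma * (2 * gamma * s)
     + l / 2 * (gamma ^+ 2 * (1 + L))) =
  (Delta / gamma + l * gamma * ((1 + L) / 2)) * s^-1 + 4 * sigma.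
  by field; rewrite !gt_eqF.
have -> : (s ^+ 2)^-1 * s = s^-1 by field; rewrite gt_eqF.
apply: lerD; last by rewrite ler_wpM2r// ler_nat.
(* The factor 3 on Delta / gamma uses Delta >= 0, which follows from minimality of f xmin. The
   logarithmic part is (1 + L) / 2 <= 3 L, from L >= 1 / 2. *)
rewrite ler_pM2r ?invr_gt0// mulrDr; apply: lerD.
  rewrite ler_peMl// ?ler1n// divr_ge0 ?(ltW hgamma)//.
  by apply: le_trans hDelta; rewrite subr_ge0.
rewrite [leRHS]mulrCA ler_pM2l ?mulr_gt0//; lra.
Qed.
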